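(* Let $G=([n],E)$ be any graph and let $C$ be a cycle in $G$ with an odd number $|C|$ of vertices (identify $C$ with its vertex set). Then the polynomial $\frac{|C|-1}{2}-\sum_{i\in C}x_i$ is $2$-sos modulo $I_G$; consequently the odd cycle inequality $\sum_{i\in C}x_i\le\frac{|C|-1}{2}$ is valid on $\mathrm{TH}_2(I_G)$.
   Context: For a graph $G=([n],E)$, $I_G\subseteq\mathbb R[x_1,\dots,x_n]$ is the ideal generated by $x_i^2-x_i$ for all $i\in[n]$ and $x_ix_j$ for all $\{i,j\}\in E$ (it is the vanishing ideal of the set of characteristic vectors of stable sets of $G$). $\mathbb{R}[\mathbf x]_k$ denotes the polynomials of degree at most $k$. A polynomial $h$ is $k$-sos modulo $I$ if there are $g_1,\dots,g_r\in\mathbb{R}[\mathbf x]_k$ with $h-\sum_i g_i^2\in I$. The $k$-th theta body is $\mathrm{TH}_k(I)=\{p\in\mathbb R^n: l(p)\ge 0$ for every $l\in\mathbb{R}[\mathbf x]_1$ that is $k$-sos modulo $I\}$. *)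

(* Defs.v *)
(* Multivariate polynomials are not available in the installed
   libraries, so real polynomials in n variables are modelled as polynomial
   functions R^n -> R (points are functions 'I_n -> R); over an infinite field
   (here any realFieldType, e.g. the reals) polynomials and polynomial
   functions correspond bijectively. *)
From HB Require Import structures.
From mathcomp Require Import all_boot all_order all_algebra.
Set Implicit Arguments. Unset Strict Implicit. Unset Printing Implicit Defensive.
Import Order.TTheory GRing.Theory Num.Theory.
Local Open Scope ring_scope.

Definition is_poly_deg (R : realFieldType) (n k : nat) (f : ('I_n -> R) -> R) : Prop :=
  exists s : seq (R * ('I_n -> nat)),
    all (fun t => (\sum_(i < n) t.2 i <= k)%N) s /\
    forall x : 'I_n -> R, f x = \sum_(t <- s) t.1 * \prod_(i < n) x i ^+ t.2 i.

Definition is_poly (R : realFieldType) (n : nat) (f : ('I_n -> R) -> R) : Prop :=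
  exists k, is_poly_deg k f.

Definition in_IG (R : realFieldType) (n : nat) (e : rel 'I_n) (h : ('I_n -> R) -> R) : Prop :=
  exists (a : 'I_n -> ('I_n -> R) -> R) (b : 'I_n -> 'I_n -> ('I_n -> R) -> R),
    (forall j, is_poly (a j)) /\ (forall i j, is_poly (b i j)) /\
    forall x : 'I_n -> R,
      h x = \sum_(j < n) a j x * (x j ^+ 2 - x j)
          + \sum_(i < n) \sum_(j < n | e i j) b i j x * (x i * x j).

Definition sos_mod (R : realFieldType) (n : nat) (k : nat) (e : rel 'I_n)
    (h : ('I_n -> R) -> R) : Prop :=
  exists (r : nat) (g : 'I_r -> ('I_n -> R) -> R),
    (forall l, is_poly_deg k (g l)) /\
    in_IG e (fun x => h x - \sum_(l < r) (g l x) ^+ 2).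

Definition TH (R : realFieldType) (n : nat) (k : nat) (e : rel 'I_n) (p : 'I_n -> R) : Prop :=
  forall l : ('I_n -> R) -> R, is_poly_deg 1 l -> sos_mod k e l -> 0 <= l p.

Definition graph_cycle (n : nat) (e : rel 'I_n) (c : seq 'I_n) : Prop :=
  [/\ (3 <= size c)%N, uniq c & cycle e c].

(* Main.v *)
Require Import Defs.
From HB Require Import structures.
From mathcomp Require Import all_boot all_order all_algebra ring.
Set Implicit Arguments. Unset Strict Implicit. Unset Printing Implicit Defensive.
Import Order.TTheory GRing.Theory Num.Theory.
Local Open Scope ring_scope.

(* Modulo I_G every x_i is idempotent and x_a x_b vanishes on edges, so for
   an edge ab the affine form 1 - x_a - x_b equals its own square; summing over
   every other edge of an even path shows that half its number of vertices
   minus the sum of its variables is a sum of squares of affine forms.  For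
   the odd cycle c0 c1 ... c2k, both x_c0 and 1 - x_c0 are idempotent, so
     x_c0 (k-1 - x_c2 - ... - x_c(2k-1)) + (1 - x_c0) (k - x_c1 - ... - x_c2k)
   is a sum of squares of quadratics, and it agrees with k - sum_C x_i up to
   the edge monomials x_c0 x_c1 and x_c2k x_c0. *)

Section PolyDeg.
Variables (R : realFieldType) (n : nat).
Local Notation poly := (('I_n -> R) -> R).

Lemma is_poly_deg_ext k (f g : poly) : f =1 g -> is_poly_deg k f -> is_poly_deg k g.
Proof. by move=> fg [s [sk fE]]; exists s; split=> // x; rewrite -fg. Qed.

Lemma is_poly_degW k k' (f : poly) : (k <= k')%N -> is_poly_deg k f -> is_poly_deg k' f.
Proof.
move=> le_kk' [s [sk fE]]; exists s; split=> //.
by apply: sub_all sk => t /leq_trans; apply.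
Qed.

Lemma is_poly_deg_cst k (a : R) : is_poly_deg k (fun _ : 'I_n -> R => a).
Proof.
exists [:: (a, fun _ => 0%N)]; split; first by rewrite /= big1.
by move=> x; rewrite big_seq1 /= big1 ?mulr1.
Qed.

Lemma is_poly_deg_var k (i : 'I_n) : (0 < k)%N -> is_poly_deg k (fun x : 'I_n -> R => x i).
Proof.
move=> k_gt0; exists [:: (1, fun j => nat_of_bool (j == i))]; split.
  by rewrite /= andbT (bigD1 i) //= eqxx big1 ?addn0 // => j /negbTE ->.
move=> x; rewrite big_seq1 /= mul1r (bigD1 i) //= eqxx big1 ?mulr1 //.
by move=> j /negbTE ->.
Qed.

Lemma is_poly_degD k (f g : poly) : is_poly_deg k f -> is_poly_deg k g ->
  is_poly_deg k (fun x => f x + g x).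
Proof.
move=> [s [sk fE]] [t [tk gE]]; exists (s ++ t); split; first by rewrite all_cat sk.
by move=> x; rewrite big_cat /= fE gE.
Qed.

Lemma is_poly_deg_monomialM k1 k2 (a : R) (m : 'I_n -> nat) (g : poly) :
  (\sum_(i < n) m i <= k1)%N -> is_poly_deg k2 g ->
  is_poly_deg (k1 + k2) (fun x => a * \prod_(i < n) x i ^+ m i * g x).
Proof.
move=> mk [t [tk gE]].
exists [seq (a * v.1, fun i => (m i + v.2 i)%N) | v <- t]; split.
  by rewrite all_map; apply: sub_all tk => v /= vk; rewrite big_split leq_add.
move=> x; rewrite gE big_map mulr_sumr; apply: eq_bigr => v _ /=.
under [in RHS]eq_bigr do rewrite exprD.
by rewrite big_split /= -!mulrA; congr (_ * _); rewrite mulrCA.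
Qed.

Lemma is_poly_degM k1 k2 (f g : poly) : is_poly_deg k1 f -> is_poly_deg k2 g ->
  is_poly_deg (k1 + k2) (fun x => f x * g x).
Proof.
move=> [s [sk fE]] gk.
apply: (@is_poly_deg_ext _ (fun x => (\sum_(t <- s) t.1 * \prod_i x i ^+ t.2 i) * g x)).
  by move=> x; rewrite fE.
elim: s sk {fE} => [_|t s IHs /andP[tk sk]].
  by apply: is_poly_deg_ext (is_poly_deg_cst _ 0) => x; rewrite big_nil mul0r.
apply: is_poly_deg_ext (is_poly_degD (is_poly_deg_monomialM t.1 tk gk) (IHs sk)).
by move=> x; rewrite big_cons mulrDl.
Qed.

Lemma is_poly_degZ k (a : R) (f : poly) : is_poly_deg k f -> is_poly_deg k (fun x => a * f x).
Proof. exact: (is_poly_degM (is_poly_deg_cst 0 a)). Qed.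

Lemma is_poly_deg_sum k (I : Type) (s : seq I) (F : I -> poly) :
  (forall i, is_poly_deg k (F i)) -> is_poly_deg k (fun x => \sum_(i <- s) F i x).
Proof.
move=> Fk; elim: s => [|i s IHs].
  by apply: is_poly_deg_ext (is_poly_deg_cst k 0) => x; rewrite big_nil.
by apply: is_poly_deg_ext (is_poly_degD (Fk i) IHs) => x; rewrite big_cons.
Qed.

Lemma is_poly_deg_cst_sub_sum (a : R) (s : seq 'I_n) :
  is_poly_deg 1 (fun x : 'I_n -> R => a - \sum_(i <- s) x i).
Proof.
have sum_s := is_poly_deg_sum s (fun i => @is_poly_deg_var 1 i isT).
apply: is_poly_deg_ext (is_poly_degD (is_poly_deg_cst 1 a) (is_poly_degZ (-1) sum_s)).
by move=> x; rewrite mulN1r.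
Qed.

Lemma is_poly_cst (a : R) : is_poly (fun _ : 'I_n -> R => a).
Proof. by exists 0%N; apply: is_poly_deg_cst. Qed.

Lemma is_polyD (f g : poly) : is_poly f -> is_poly g -> is_poly (fun x => f x + g x).
Proof.
move=> [k1 fk] [k2 gk]; exists (maxn k1 k2).
by apply: is_poly_degD; [apply: is_poly_degW fk | apply: is_poly_degW gk];
  rewrite ?leq_maxl ?leq_maxr.
Qed.

Lemma is_polyM (f g : poly) : is_poly f -> is_poly g -> is_poly (fun x => f x * g x).
Proof. by move=> [k1 fk] [k2 gk]; exists (k1 + k2)%N; apply: is_poly_degM. Qed.

End PolyDeg.

Section IdealIG.
Variables (R : realFieldType) (n : nat) (e : rel 'I_n).
Local Notation poly := (('I_n -> R) -> R).

Lemma in_IG_ext (f g : poly) : f =1 g -> in_IG e f -> in_IG e g.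
Proof.
move=> fg [a [b [ap [bp fE]]]]; exists a, b; split=> //; split=> // x.
by rewrite -fg.
Qed.

Lemma in_IG0 : in_IG e (fun _ : 'I_n -> R => 0).
Proof.
exists (fun _ _ => 0), (fun _ _ _ => 0); split; [|split]=> [?|??|x]; try exact: is_poly_cst.
rewrite big1 ?add0r ?big1 // => i _; last by rewrite mul0r.
by rewrite big1 // => j _; rewrite mul0r.
Qed.

Lemma in_IGD (f g : poly) : in_IG e f -> in_IG e g -> in_IG e (fun x => f x + g x).
Proof.
move=> [a1 [b1 [ap1 [bp1 fE]]]] [a2 [b2 [ap2 [bp2 gE]]]].
exists (fun j x => a1 j x + a2 j x), (fun i j x => b1 i j x + b2 i j x).
split; [|split]=> [j|i j|x]; try by apply: is_polyD.
rewrite fE gE addrACA; congr (_ + _); rewrite -big_split.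
  by apply: eq_bigr => j _; rewrite mulrDl.
by apply: eq_bigr => i _; rewrite -big_split; apply: eq_bigr => j _; rewrite mulrDl.
Qed.

Lemma in_IGM (p h : poly) : is_poly p -> in_IG e h -> in_IG e (fun x => p x * h x).
Proof.
move=> pp [a [b [ap [bp hE]]]].
exists (fun j x => p x * a j x), (fun i j x => p x * b i j x).
split; [|split]=> [j|i j|x]; try by apply: is_polyM.
rewrite hE mulrDr !mulr_sumr; congr (_ + _).
  by apply: eq_bigr => j _; rewrite mulrA.
by apply: eq_bigr => i _; rewrite mulr_sumr; apply: eq_bigr => j _; rewrite mulrA.
Qed.

Lemma in_IG_idem (j : 'I_n) : in_IG e (fun x : 'I_n -> R => x j ^+ 2 - x j).
Proof.
exists (fun j' _ => (j' == j)%:R), (fun _ _ _ => 0); split; [|split]=> [?|??|x];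
  try exact: is_poly_cst.
rewrite [X in _ = _ + X]big1 => [|i _]; last by rewrite big1 // => k _; rewrite mul0r.
rewrite addr0 (bigD1 j) //= eqxx mul1r big1 ?addr0 // => k /negbTE ->.
by rewrite mul0r.
Qed.

Lemma in_IG_edge (i j : 'I_n) : e i j -> in_IG e (fun x : 'I_n -> R => x i * x j).
Proof.
move=> eij; exists (fun _ _ => 0), (fun i' j' _ => ((i' == i) && (j' == j))%:R).
split; [|split]=> [?|??|x]; try exact: is_poly_cst.
rewrite big1 ?add0r => [|k _]; last by rewrite mul0r.
rewrite (bigD1 i) //= [X in _ = _ + X]big1 ?addr0 => [|k /negbTE ki]; last first.
  by rewrite big1 // => l _; rewrite ki mul0r.
rewrite (bigD1 j) //= !eqxx mul1r big1 ?addr0 // => l /andP[_ /negbTE ->].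
by rewrite andbF mul0r.
Qed.

Lemma in_IGZ (a : R) (h : poly) : in_IG e h -> in_IG e (fun x => a * h x).
Proof. exact/in_IGM/is_poly_cst. Qed.

Definition eqmodIG (f g : poly) := in_IG e (fun x => f x - g x).

Lemma eqmodIG_eq (f g : poly) : f =1 g -> eqmodIG f g.
Proof. by move=> fg; apply: in_IG_ext in_IG0 => x; rewrite fg subrr. Qed.

Lemma eqmodIG_trans (g f h : poly) : eqmodIG f g -> eqmodIG g h -> eqmodIG f h.
Proof. by move=> fg gh; apply: in_IG_ext (in_IGD fg gh) => x; ring. Qed.

Lemma eqmodIG_sym (f g : poly) : eqmodIG f g -> eqmodIG g f.
Proof. by move=> fg; apply: in_IG_ext (in_IGZ (-1) fg) => x; ring. Qed.

Lemma eqmodIGD (f g f' g' : poly) : eqmodIG f g -> eqmodIG f' g' ->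
  eqmodIG (fun x => f x + f' x) (fun x => g x + g' x).
Proof. by move=> fg fg'; apply: in_IG_ext (in_IGD fg fg') => x; ring. Qed.

Lemma eqmodIGM (p f g : poly) : is_poly p -> eqmodIG f g ->
  eqmodIG (fun x => p x * f x) (fun x => p x * g x).
Proof. by move=> pp fg; apply: in_IG_ext (in_IGM pp fg) => x; ring. Qed.

End IdealIG.

Section SumsOfSquares.
Variables (R : realFieldType) (n : nat) (e : rel 'I_n).
Local Notation poly := (('I_n -> R) -> R).

Fixpoint all_poly_deg k (gs : seq poly) : Prop :=
  if gs is g :: gs' then is_poly_deg k g /\ all_poly_deg k gs' else True.

Definition is_sos k (h : poly) :=
  exists2 gs, all_poly_deg k gs & eqmodIG e h (fun x => \sum_(g <- gs) g x ^+ 2).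

Lemma is_sos_eqmod k (h h' : poly) : eqmodIG e h h' -> is_sos k h' -> is_sos k h.
Proof. by move=> hh' [gs gsk h'E]; exists gs => //; apply: eqmodIG_trans h'E. Qed.

Lemma is_sos0 k : is_sos k (fun _ => 0).
Proof. by exists [::] => //; apply: (eqmodIG_eq e) => x; rewrite big_nil. Qed.

Lemma is_sosD k (h1 h2 : poly) : is_sos k h1 -> is_sos k h2 -> is_sos k (fun x => h1 x + h2 x).
Proof.
move=> [gs1 gs1k h1E] [gs2 gs2k h2E]; exists (gs1 ++ gs2).
  by elim: gs1 gs1k {h1E} => //= g gs1 IHgs [gk gs1k]; split; last exact: IHgs.
apply: eqmodIG_trans (eqmodIGD h1E h2E) _.
by apply: (eqmodIG_eq e) => x; rewrite big_cat.
Qed.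

Lemma is_poly_deg_sum_sq k (gs : seq poly) : all_poly_deg k gs ->
  is_poly_deg (k + k) (fun x => \sum_(g <- gs) g x ^+ 2).
Proof.
elim: gs => [_|g gs IHgs [gk gsk]].
  by apply: is_poly_deg_ext (is_poly_deg_cst _ _ 0) => x; rewrite big_nil.
apply: is_poly_deg_ext (is_poly_degD (is_poly_degM gk gk) (IHgs gsk)) => x.
by rewrite big_cons expr2.
Qed.

(* As t^2 = t modulo I_G, t * sum g^2 = sum (t g)^2 modulo I_G. *)
Lemma is_sos_mul_idem k (t h : poly) : is_poly_deg 1 t ->
  eqmodIG e (fun x => t x ^+ 2) t -> is_sos k h -> is_sos k.+1 (fun x => t x * h x).
Proof.
move=> t1 t_idem [gs gsk hE]; exists [seq (fun x => t x * g x) | g <- gs].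
  elim: gs gsk {hE} => //= g gs IHgs [gk gsk].
  by split; [exact: (is_poly_degM t1 gk) | exact: IHgs].
have tp : is_poly t by exists 1%N.
have sum_gs_p : is_poly (fun x => \sum_(g <- gs) g x ^+ 2).
  by exists (k + k)%N; apply: is_poly_deg_sum_sq.
apply: eqmodIG_trans (eqmodIGM tp hE) _; apply: eqmodIG_sym.
have tgs_sq : (fun x => \sum_(f <- [seq (fun y => t y * g y) | g <- gs]) f x ^+ 2)
    =1 (fun x => (\sum_(g <- gs) g x ^+ 2) * t x ^+ 2).
  by move=> x; rewrite big_map mulr_suml; apply: eq_bigr => g _; rewrite exprMn mulrC.
apply: (eqmodIG_trans (eqmodIG_eq e tgs_sq)).
apply: (eqmodIG_trans (eqmodIGM sum_gs_p t_idem)).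
by apply: (eqmodIG_eq e) => x; rewrite mulrC.
Qed.

Lemma sos_mod_of_is_sos k (h : poly) : is_sos k h -> sos_mod k e h.
Proof.
move=> [gs gsk hE]; pose g0 : poly := fun _ => 0.
have gs_k i : is_poly_deg k (nth g0 gs i).
  elim: gs gsk i {hE} => [_ i|g gs IHgs [gk gsk] [|i]] //=; last exact: IHgs.
  by rewrite nth_nil; apply: is_poly_deg_cst.
exists (size gs), (fun l => nth g0 gs l); split=> //.
by apply: in_IG_ext hE => x; rewrite (big_nth g0) big_mkord.
Qed.

End SumsOfSquares.

Section OddCycle.
Variables (R : realFieldType) (n : nat) (e : rel 'I_n).

Lemma eqmodIG_var_sq (i : 'I_n) : eqmodIG e (fun x : 'I_n -> R => x i ^+ 2) (fun x => x i).
Proof. exact: in_IG_idem. Qed.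

Lemma eqmodIG_compl_var_sq (i : 'I_n) :
  eqmodIG e (fun x : 'I_n -> R => (1 - x i) ^+ 2) (fun x => 1 - x i).
Proof. by apply: in_IG_ext (in_IG_idem R e i) => x; ring. Qed.

Lemma is_sos_edge (a b : 'I_n) : e a b -> is_sos e 1 (fun x : 'I_n -> R => 1 - x a - x b).
Proof.
move=> eab; exists [:: fun x => 1 - x a - x b].
  split=> //; apply: is_poly_deg_ext (is_poly_deg_cst_sub_sum 1 [:: a; b]) => x.
  by rewrite !big_cons big_nil; ring.
have ab := in_IGZ (-2) (in_IG_edge R eab).
have aa := in_IGZ (-1) (in_IG_idem R e a); have bb := in_IGZ (-1) (in_IG_idem R e b).
by apply: in_IG_ext (in_IGD (in_IGD aa bb) ab) => x; rewrite big_seq1; ring.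
Qed.

(* The start vertex a is not in s; s is covered by the edges s0 s1, s2 s3, ... *)
Lemma is_sos_even_path (a : 'I_n) (s : seq 'I_n) : path e a s -> ~~ odd (size s) ->
  is_sos e 1 (fun x : 'I_n -> R => ((size s)./2)%:R - \sum_(i <- s) x i).
Proof.
have [m] := ubnP (size s); elim: m a s => // m IHm a [|b [|c s]] //= lt_s_m.
  move=> _ _; apply: is_sos_eqmod (is_sos0 R e 1).
  by apply: eqmodIG_eq => x; rewrite big_nil subr0.
move=> /and3P[_ ebc p_cs]; rewrite negbK => even_s.
have := is_sosD (is_sos_edge ebc) (IHm c s (ltnW lt_s_m) p_cs even_s).
apply: is_sos_eqmod; apply: eqmodIG_eq => x.
by rewrite !big_cons mulrS; ring.
Qed.

Lemma is_sos_odd_cycle (c : seq 'I_n) : graph_cycle e c -> odd (size c) ->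
  is_sos e 2 (fun x : 'I_n -> R => ((size c).-1)%:R / 2 - \sum_(i <- c) x i).
Proof.
case=> size_c _; case: c size_c => [|c0 [|c1 t]] // _.
case/lastP: t => [|mid cl]; first by rewrite /cycle /= andbC.
rewrite /cycle rcons_path /= last_rcons => /andP[/andP[e01 p1] el0].
rewrite size_rcons /= negbK => even_mid.
have p_mid : path e c1 mid by move: p1; rewrite rcons_path => /andP[].
have p_c1 : path e c0 (c1 :: rcons mid cl) by rewrite /= e01.
have even_c1 : ~~ odd (size (c1 :: rcons mid cl)) by rewrite /= size_rcons negbK.
have compl_c0 : is_poly_deg 1 (fun x : 'I_n -> R => 1 - x c0).
  by apply: is_poly_deg_ext (is_poly_deg_cst_sub_sum 1 [:: c0]) => x; rewrite big_seq1.
have S1 := is_sos_mul_idem (is_poly_deg_var R (k := 1) c0 isT) (eqmodIG_var_sq c0)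
  (is_sos_even_path p_mid even_mid).
have S2 := is_sos_mul_idem compl_c0 (eqmodIG_compl_var_sq c0)
  (is_sos_even_path p_c1 even_c1).
apply: is_sos_eqmod (is_sosD S1 S2).
have edges := in_IGD (in_IGZ (-1) (in_IG_edge R e01)) (in_IGZ (-1) (in_IG_edge R el0)).
apply: in_IG_ext edges => x.
have mid_double : size mid = ((size mid)./2).*2.
  by rewrite -[LHS]odd_double_half (negbTE even_mid).
rewrite /= size_rcons /= !big_cons big_rcons /=.
rewrite [in (size mid).+2]mid_double -doubleS -muln2 natrM mulfK ?pnatr_eq0 //.
by rewrite mid_double doubleK !mulrS; ring.
Qed.

End OddCycle.

Theorem mainTheorem7 (R : realFieldType) (n : nat) (e : rel 'I_n)
    (e_sym : symmetric e) (e_irr : irreflexive e) (c : seq 'I_n)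
    (hc : graph_cycle e c) (hodd : odd (size c)) :
  sos_mod 2 e (fun x : 'I_n -> R => ((size c).-1)%:R / 2 - \sum_(i <- c) x i) /\
  (forall p : 'I_n -> R, TH 2 e p -> \sum_(i <- c) p i <= ((size c).-1)%:R / 2).
Proof.
have sos_c := sos_mod_of_is_sos (is_sos_odd_cycle R hc hodd).
split=> [|p TH_p]; first exact: sos_c.
have lin_c := @is_poly_deg_cst_sub_sum R n ((size c).-1%:R / 2) c.
by have := TH_p _ lin_c sos_c; rewrite subr_ge0.
Qed.
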